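(* Let $k$ be a positive integer and let $p$ be a binary word of length $\ell$ with $r\ge 2$ runs. Then for $n$ sufficiently large, $B_p(n,k)$ is a polynomial in $n$ of degree at most $\ell-r+1$. Furthermore, if either (i) $p$ has a run of length $1$, or (ii) $p$ has a run of length $b\ge 2$ at its boundary such that $\binom{b+s}{b}=k$ for some integer $s\ge 0$, then $\deg(B_p(n,k))=\ell-r+1$.
   Context: A binary word of length $n$ is a string $w=w_1\cdots w_n\in\{0,1\}^n$. An occurrence of $p=p_1\cdots p_\ell$ in $w=w_1\cdots w_n$ is a choice of indices $1\le i_1<\cdots<i_\ell\le n$ (not necessarily consecutive) such that $w_{i_1}\cdots w_{i_\ell}=p$. Let $c_p(w)$ be the number of occurrences of $p$ in $w$, and let $B_p(n,k)=|\{w\in\{0,1\}^n : c_p(w)=k\}|$. A run of length $L$ in a binary word is a maximal block of $L$ consecutive equal letters. A run is at the boundary of $p$ if it is the first or the last run of $p$. The degree of $B_p(n,k)$ means the degree of the polynomial in $n$ with which $B_p(n,k)$ agrees for all sufficiently large $n$ ($k$ and $p$ fixed). *)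

(* Defs.v *)
From mathcomp Require Import all_boot all_order all_algebra.

Set Implicit Arguments.
Unset Strict Implicit.
Unset Printing Implicit Defensive.

(* Binary words of length n are n.-tuple bool, with letters indexed by 'I_n. *)

Definition occurrences (l n : nat) (p : l.-tuple bool) (w : n.-tuple bool) :
    {set l.-tuple 'I_n} :=
  [set t : l.-tuple 'I_n |
     sorted ltn [seq val i | i <- t] && ([seq tnth w i | i <- t] == p)].

Definition num_occ (l n : nat) (p : l.-tuple bool) (w : n.-tuple bool) : nat :=
  #|occurrences p w|.

Definition num_words (l : nat) (p : l.-tuple bool) (n k : nat) : nat :=
  #|[set w : n.-tuple bool | num_occ p w == k]|.

(* Each run is recorded, from left to right, as a pair (letter, length);
   flatten_runs, runs_pos and runs_alt below say that these are the maximal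
   constant blocks of s. *)
Fixpoint runs (s : seq bool) : seq (bool * nat) :=
  if s is a :: s' then
    if runs s' is (c, m) :: rs then
      if a == c then (c, m.+1) :: rs else (a, 1) :: (c, m) :: rs
    else [:: (a, 1)]
  else [::].

Definition run_lengths (s : seq bool) : seq nat := [seq x.2 | x <- runs s].

Definition boundary_run_length (s : seq bool) (b : nat) : Prop :=
  b = head 0 (run_lengths s) \/ b = last 0 (run_lengths s).

Definition eventually_poly (f : nat -> nat) (q : {poly rat}) : Prop :=
  exists N : nat, forall n : nat, N <= n -> ((f n)%:R = q.[n%:R])%R.

Lemma flatten_runs (s : seq bool) :
  flatten [seq nseq x.2 x.1 | x <- runs s] = s.
Proof.
elim: s => //= a s; case: (runs s) => [|[c m] rs] /= IH; first by rewrite -IH.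
by case: eqP => [->|_] /=; rewrite -IH.
Qed.

Lemma runs_pos (s : seq bool) : all (fun x => 0 < x.2) (runs s).
Proof.
elim: s => //= a s; case: (runs s) => [|[c m] rs] //= /andP[m0 H].
by case: ifP => _ /=; rewrite ?m0 H.
Qed.

Lemma runs_alt (s : seq bool) :
  sorted (fun x y => x.1 != y.1) (runs s).
Proof.
elim: s => //= a s; case: (runs s) => [|[c m] rs] //= H.
case: eqP => [_|/eqP ac] /=; last by rewrite ac.
by case: rs H.
Qed.

(* Main.v *)
Require Import Defs.
From mathcomp Require Import all_boot all_order all_algebra.
From mathcomp Require Import zify ring.

(* Read a word from left to right, keeping the number of occurrences of each
   prefix of p. A count exceeding k can be treated as infinite, so there are
   finitely many states; the counts only grow, so the transition graph is acyclic
   except for self-loops. No state from which exactly k occurrences of p are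
   still possible has two self-loops. Hence the number of accepted continuations
   of length n is a sum of shifted counts (no loop) or an antidifference (one
   loop), and it is a polynomial for large n whose degree is smaller than the
   maximal number of looping states on a path. Along a path the looping states
   correspond to distinct gaps between equal consecutive letters of p, or to one
   of the two ends of p: at most l - r + 2 in total.

   For the converse, embed p letter by letter, reading many copies of the opposite
   letter in each of these l - r + 2 gaps; this keeps the number of occurrences
   and makes every gap a looping state. To get k occurrences instead of one,
   repeat the letter of a run of length 1 k times, or lengthen a boundary run from
   b to b + s letters. *)

Set Implicit Arguments.
Unset Strict Implicit.
Unset Printing Implicit Defensive.

(** * Counting words and occurrences *)

(** Branching on the first letter makes the recurrences in [n] hold by computation. *)
Fixpoint cnt (P : pred (seq bool)) (n : nat) : nat :=
  if n is n'.+1 then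
    cnt (fun w => P (false :: w)) n' + cnt (fun w => P (true :: w)) n'
  else P [::].

Lemma eq_cnt P Q n : P =1 Q -> cnt P n = cnt Q n.
Proof.
elim: n P Q => [|n IH] P Q PQ /=; first by rewrite PQ.
by congr (_ + _); apply: IH => w; rewrite PQ.
Qed.

Lemma cnt_pred0 n : cnt pred0 n = 0.
Proof. by elim: n => //= n IH; rewrite (eq_cnt (Q := pred0)) // IH. Qed.

Lemma cntS P n x :
  cnt P n.+1 = cnt (fun w => P (x :: w)) n + cnt (fun w => P (~~ x :: w)) n.
Proof. by case: x => //=; rewrite addnC. Qed.

Lemma card_tuple_cnt (P : pred (seq bool)) n :
  #|[set t : n.-tuple bool | P t]| = cnt P n.
Proof.
transitivity (\sum_(t : n.-tuple bool) P t).
  by rewrite -sum1dep_card big_mkcond; apply: eq_bigr => t _; case: (P t).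
elim: n P => [|n IH] P /=.
  rewrite (big_pred1 [tuple]) // => t; rewrite (tuple0 t).
  exact/esym/eqP.
rewrite -!IH addnC.
rewrite (reindex (fun z : bool * n.-tuple bool => [tuple of z.1 :: z.2])).
  by rewrite -(pair_bigA _ (fun b (t : n.-tuple bool) => nat_of_bool (P (b :: t))))
       big_bool.
exists (fun t : n.+1.-tuple bool => (thead t, [tuple of behead t])) => [[b t]|t] _.
  by congr pair; apply: val_inj.
by rewrite /= [RHS]tuple_eta.
Qed.

Fixpoint occ (p w : seq bool) : nat :=
  if w is b :: w' then
    occ p w' + (if p is a :: p' then (a == b) * occ p' w' else 0)
  else p == [::].

Lemma occ_nil w : occ [::] w = 1.
Proof. by elim: w => //= b w ->. Qed.

Lemma cnt_mask p w : cnt (fun m => mask m w == p) (size w) = occ p w.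
Proof.
elim: w p => [|b w IH] p /=; first by rewrite eq_sym.
congr (_ + _); first exact: IH.
case: p => [|a p] //; first by rewrite (eq_cnt (Q := pred0)) ?cnt_pred0.
rewrite -IH eq_sym; case: eqP => [<-|ba].
  by rewrite mul1n; apply: eq_cnt => m; rewrite eqseq_cons eqxx.
rewrite (eq_cnt (Q := pred0)) ?cnt_pred0 // => m.
by rewrite eqseq_cons; apply/negbTE; case: eqP.
Qed.

(** An increasing index tuple is recovered from its characteristic mask [h t], so occurrences
    correspond to the masks that select [p]. *)
Lemma num_occE l n (p : l.-tuple bool) (w : n.-tuple bool) :
  num_occ p w = occ p w.
Proof.
pose h (t : l.-tuple 'I_n) := [tuple (i \in t) | i < n].
have hE (t : l.-tuple 'I_n) : h t = [seq i \in t | i <- enum 'I_n] :> seq bool.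
  by [].
have sorted_val (s : seq 'I_n) :
    sorted ltn [seq val i | i <- s] = sorted (relpre val ltn) s.
  by rewrite sorted_map.
have tr : transitive (relpre (@nat_of_ord n) ltn) by move=> x y z; apply: ltn_trans.
have ir : irreflexive (relpre (@nat_of_ord n) ltn) by move=> x; apply: ltnn.
have s_en : sorted (relpre (@nat_of_ord n) ltn) (enum 'I_n).
  by rewrite -sorted_val val_enum_ord iota_ltn_sorted.
have hK (t : l.-tuple 'I_n) : sorted ltn [seq val i | i <- t] ->
    mask (h t) (enum 'I_n) = t.
  rewrite sorted_val hE -filter_mask => st.
  apply: (irr_sorted_eq tr ir) => //; first exact: sorted_filter.
  by move=> i; rewrite mem_filter mem_enum andbT.
have wE : w = [seq tnth w i | i <- enum 'I_n] :> seq bool.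
  by rewrite map_tnth_enum.
rewrite -cnt_mask size_tuple -card_tuple_cnt /num_occ.
rewrite -(card_in_imset (f := h) (D := occurrences p w)); last first.
  move=> t1 t2; rewrite !inE => /andP[/hK k1 _] /andP[/hK k2 _] e.
  by apply: val_inj; rewrite /= -k1 -k2 e.
congr #|pred_of_set _|; apply/setP => m; rewrite inE; apply/imsetP/idP.
  case=> t; rewrite inE => /andP[/hK k1 /eqP e] ->.
  by rewrite wE -map_mask k1 e.
rewrite wE -map_mask => /eqP e.
have sz : size (mask m (enum 'I_n)) == l.
  by rewrite -(size_map (tnth w)) e size_tuple.
exists (Tuple sz).
  by rewrite inE /= e eqxx andbT sorted_val sorted_mask.
apply: val_inj; apply: (etrans _ (esym (hE _))).
apply: (@eq_from_nth _ false) => [|i].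
  by rewrite size_map size_enum_ord size_tuple.
rewrite size_tuple => lin.
rewrite (nth_map (Ordinal lin)) ?size_enum_ord // in_mask ?enum_uniq // mem_enum /=.
by rewrite index_uniq ?size_enum_ord ?enum_uniq.
Qed.

Lemma num_wordsE l (p : l.-tuple bool) n k :
  num_words p n k = cnt (fun w => occ p w == k) n.
Proof.
rewrite /num_words -card_tuple_cnt; congr #|pred_of_set _|.
by apply/setP => w; rewrite !inE num_occE.
Qed.

(** * Eventually polynomial functions *)

Section EventualPolynomials.
Local Open Scope ring_scope.
Import Order.TTheory GRing.Theory Num.Theory.

Lemma poly_antidifference (q : {poly rat}) :
  exists2 Q : {poly rat}, (size Q <= (size q).+1)%N &
    forall n : nat, Q.[n.+1%:R] = Q.[n%:R] + q.[n%:R].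
Proof.
(* The falling factorials [B m] = X(X-1)...(X-m+1) satisfy
   [B m.+1 (n+1) - B m.+1 n = m.+1 * B m n]. *)
pose B m : {poly rat} := \prod_(i <- iota 0 m) ('X - (i%:R)%:P).
have szB m : size (B m) = m.+1 by rewrite size_prod_XsubC size_iota.
have BE m x : (B m).[x] = \prod_(i < m) (x - i%:R).
  rewrite /B horner_prod -(big_mkord xpredT (fun i => x - i%:R)) /index_iota subn0.
  by apply: eq_bigr => i _; rewrite hornerXsubC.
have lB m : (B m)`_m = 1.
  by have /monicP := monic_prod_XsubC (iota 0 m) xpredT (fun i => i%:R : rat);
     rewrite /lead_coef szB.
have BS m n : (B m.+1).[n.+1%:R] = (B m.+1).[n%:R] + m.+1%:R * (B m).[n%:R].
  rewrite !BE big_ord_recl [in RHS]big_ord_recr /= subr0.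
  rewrite (eq_bigr (fun i : 'I_m => n%:R - i%:R)); last first.
    by move=> i _; rewrite /bump /= add1n -!natr1; ring.
  by rewrite -!natr1; ring.
have [m] := ubnP (size q); elim: m q => // m IH q szq.
have [->|q0] := eqVneq q 0.
  by exists 0 => [|n]; rewrite ?size_poly0 // !horner0 addr0.
pose s := (size q).-1.
have sq : size q = s.+1 by rewrite /s prednK // size_poly_gt0.
pose q' := q - q`_s *: B s.
have sq' : (size q' <= s)%N.
  apply/leq_sizeP => j; rewrite leq_eqVlt coefB coefZ => /orP[/eqP <-|sj].
    by rewrite lB mulr1 subrr.
  by rewrite [q`_j]nth_default ?sq // [(B s)`_j]nth_default ?szB // mulr0 subr0.
have [|Q' sQ' Q'S] := IH q'; first by apply: leq_ltn_trans sq' _; rewrite -ltnS -sq.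
exists (Q' + (q`_s / s.+1%:R) *: B s.+1) => [|n].
  rewrite (leq_trans (size_polyD _ _)) // geq_max sq.
  rewrite (leq_trans sQ') ?ltnS ?(leq_trans sq') //=.
  by rewrite (leq_trans (size_scale_leq _ _)) ?szB.
have s0 : s.+1%:R != 0 :> rat by rewrite pnatr_eq0.
rewrite !hornerD !hornerZ Q'S BS /q' hornerD hornerN hornerZ mulrDr.
by rewrite [_ / _ * (_ * _)]mulrA divfK //; ring.
Qed.

Lemma eventually_poly_antidiff f g q :
  (forall n, f n.+1 = f n + g n)%N -> eventually_poly g q ->
  exists2 Q, eventually_poly f Q & (size Q <= (size q).+1)%N.
Proof.
move=> fS [N gN]; have [Q sQ QS] := poly_antidifference q.
(* The constant forces agreement with [f] at [N]; from there on both satisfy the same recurrence. *)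
exists (Q + ((f N)%:R - Q.[N%:R])%:P).
  exists N; elim=> [|n IH]; rewrite hornerD hornerC ?leqn0.
    by move=> /eqP N0; rewrite N0; ring.
  rewrite leq_eqVlt ltnS => /orP[/eqP <-|Nn]; first by ring.
  rewrite fS natrD gN // IH // QS hornerD hornerC; ring.
rewrite (leq_trans (size_polyD _ _)) // geq_max sQ.
by rewrite (leq_trans (size_polyC_leq1 _)).
Qed.

Lemma eventually_poly_shift f g h q q' :
  (forall n, f n.+1 = g n + h n)%N -> eventually_poly g q ->
  eventually_poly h q' ->
  exists2 Q, eventually_poly f Q & (size Q <= maxn (size q) (size q'))%N.
Proof.
move=> fS [N gN] [M hM]; exists ((q + q') \Po ('X - 1%:P)).
  exists (maxn N M).+1 => -[//|n]; rewrite ltnS geq_max => /andP[Nn Mn].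
  rewrite fS natrD gN // hM // horner_comp hornerXsubC -natr1 addrK.
  by rewrite hornerD.
by rewrite size_comp_poly2 ?size_XsubC // size_polyD.
Qed.

(** Choosing one element from each of [d] blocks of size [m] gives [m ^ d] subsets; only the
    Vandermonde term of index 1 is kept. *)
Lemma exp_le_bin m d : (m ^ d <= 'C(d * m, d))%N.
Proof.
elim: d => [|d IH]; first by rewrite bin0.
rewrite mulSn -binomial.Vandermonde.
rewrite (bigD1 (inord 1)) //= inordK ?ltnS // bin1 subSS subn0 expnS.
by rewrite (leq_trans _ (leq_addr _ _)) // leq_mul2l IH orbT.
Qed.

(** If [size q <= d], then [n] times the value of [q] at [n] is at most a constant times [n ^ d]. At
    [n = N + d.+1 * m] that value is at least [m ^ d] while [m <= n], which bounds [m]. *)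
Lemma eventually_poly_growth f q N d :
  eventually_poly f q -> (forall n, 'C(n, d) <= f (N + n))%N ->
  (d < size q)%N.
Proof.
move=> [M fM] fC; rewrite ltnNge; apply/negP => sq.
pose A := \sum_(i < size q) `|q`_i|.
have A0 : 0 <= A by apply: sumr_ge0.
have qA n : (0 < n)%N -> `|q.[n%:R]| * n%:R <= A * n%:R ^+ d.
  move=> n0; rewrite horner_coef /A mulr_suml.
  apply: le_trans (ler_wpM2r _ (ler_norm_sum _ _ _)) _ => //.
  rewrite mulr_suml ler_sum // => i _.
  rewrite normrM -mulrA ler_wpM2l // normrX ger0_norm // -exprSr.
  by apply: ler_weXn2l; rewrite ?ler1n // (leq_trans _ sq).
pose C := A * (N + d.+1)%:R ^+ d.
have C0 : 0 <= C by rewrite mulr_ge0 ?exprn_ge0.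
pose m := (maxn M (Num.Def.archi_bound C)).+1.
have m0 : (0 < m)%N by [].
pose n := (N + d.+1 * m)%N.
have mn : (m <= n)%N by rewrite /n; nia.
have Mn : (M <= n)%N by apply: leq_trans mn; rewrite /m; lia.
have := qA n (leq_trans m0 mn).
rewrite -fM // normr_nat => H.
have {H} H : (m ^ d * m)%:R <= C * (m ^ d)%:R.
  apply: le_trans (le_trans H _); first last.
    rewrite /C -mulrA ler_wpM2l // natrX -exprMn lerXn2r ?nnegrE ?mulr_ge0 //.
    by rewrite -natrM ler_nat /n; nia.
  rewrite -natrM ler_nat leq_mul // (leq_trans (exp_le_bin m d)) //.
  by rewrite (leq_trans _ (fC _)) // leq_bin2l // mulSn leq_addl.
have : (m%:R : rat) <= C.
  by move: H; rewrite natrM mulrC ler_pM2r // ltr0n expn_gt0 m0.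
apply/negP; rewrite -ltNge (lt_trans (archi_boundP C0)) // ltr_nat /m; lia.
Qed.

End EventualPolynomials.

(** * The automaton of capped prefix counts *)

Lemma occ_drop_gt0 p w i j : i <= j -> 0 < occ (drop i p) w ->
  0 < occ (drop j p) w.
Proof.
have occ_behead q v : 0 < occ q v -> 0 < occ (behead q) v.
  elim: v q => [|b v IH] [|a q] //=.
  rewrite addn_gt0 muln_gt0 => /orP[/IH /= qv|/andP[_ qv]].
    by rewrite addn_gt0 qv.
  by rewrite addn_gt0 qv.
move=> /subnKC <-; elim: (j - i) => [|d IH]; first by rewrite addn0.
by move=> /IH /occ_behead; rewrite addnS -drop1 drop_drop add1n.
Qed.

Lemma ltn_sum_ord n (F G : 'I_n -> nat) j :
  (forall i, F i <= G i) -> F j < G j -> \sum_i F i < \sum_i G i.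
Proof.
move=> FG Fj; rewrite (bigD1 j) //= [X in _ < X](bigD1 j) //=.
by rewrite -addSn leq_add // leq_sum.
Qed.

Section States.
Variables (k : nat) (p : seq bool).
Hypothesis k0 : 0 < k.
Let l := size p.
Let P j := nth false p j.

(* A state [c] records that the prefix of length [j] of [p] has occurred [c j]
   times in the word read so far; [total c w] is then the number of occurrences
   of [p] once [w] has been read as well. *)
Definition step (x : bool) (c : nat -> nat) (j : nat) : nat :=
  c j + (if j is i.+1 then (P i == x) * c i else 0).

Definition total (c : nat -> nat) (w : seq bool) : nat :=
  \sum_(j < l.+1) c j * occ (drop j p) w.

Definition completions (c : nat -> nat) (n : nat) : nat :=
  cnt (fun w => total c w == k) n.

Definition init_state (j : nat) : nat := j == 0.

Lemma total_init w : total init_state w = occ p w.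
Proof.
rewrite /total big_ord_recl /= drop0 mul1n big1 ?addn0 // => i _.
Qed.

Lemma total_step x c w :
  total (step x c) w =
  total c w + \sum_(j < l) (P j == x) * c j * occ (drop j.+1 p) w.
Proof.
rewrite /total /step.
under eq_bigr do rewrite mulnDl.
by rewrite big_split /= [X in _ + X = _]big_ord_recl /= add0n.
Qed.

Lemma total_cons c x w : total c (x :: w) = total (step x c) w.
Proof.
rewrite total_step /total !big_ord_recr /= drop_size !occ_nil addnAC.
congr (_ + _); rewrite -big_split; apply: eq_bigr => j _ /=.
by rewrite (drop_nth false (ltn_ord j)) /= mulnDr; congr (_ + _); rewrite mulnA [_ * c j]mulnC.
Qed.

Lemma total_nil c : total c [::] = c l.
Proof.
rewrite /total big_ord_recr /= drop_size muln1 big1 // => j _.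
by rewrite (drop_nth false (ltn_ord j)) muln0.
Qed.

Lemma completionsS c x n :
  completions c n.+1 = completions (step x c) n + completions (step (~~ x) c) n.
Proof.
by rewrite /completions (cntS _ _ x); congr (_ + _); apply: eq_cnt => w;
   rewrite total_cons.
Qed.

(* Reading [x] then only increases counts that already exceed [k], so it does
   not change which continuations lead to exactly [k] occurrences of [p]. *)
Definition looping x (c : nat -> nat) : bool :=
  [forall j : 'I_l, (P j == x) ==> ((c j == 0) || (k < c j.+1))].

Lemma loopingP x c :
  reflect (forall j, j < l -> P j = x -> c j = 0 \/ k < c j.+1) (looping x c).
Proof.
apply: (iffP forallP) => [H j jl Pj|H j].
  by have := H (Ordinal jl); rewrite /= Pj eqxx => /orP[/eqP|]; [left|right].
by apply/implyP => /eqP /(H _ (ltn_ord j))[->|->]; rewrite ?orbT.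
Qed.

Lemma leq_total c w j : j <= l -> 0 < occ (drop j p) w -> c j <= total c w.
Proof.
move=> jl oj; rewrite /total (bigD1 (Ordinal (jl : j < l.+1))) //=.
by rewrite (leq_trans _ (leq_addr _ _)) // leq_pmulr.
Qed.

(** A nonzero added term has [k < c j.+1] and a remaining suffix that occurs in [w], so both totals
    exceed [k]. *)
Lemma looping_total x c w : looping x c ->
  (total (step x c) w == k) = (total c w == k).
Proof.
move=> /loopingP lx; rewrite total_step.
have [->|] := posnP (\sum_(j < l) (P j == x) * c j * occ (drop j.+1 p) w).
  by rewrite addn0.
rewrite lt0n sum_nat_eq0 => /forallPn[j] /=.
rewrite -lt0n !muln_gt0 lt0b => /andP[/andP[/eqP Pj cj] oj].
have [cj0|kc] := lx _ (ltn_ord j) Pj; first by rewrite cj0 in cj.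
have := leq_total c (ltn_ord j : j.+1 <= l) oj.
by move=> H; rewrite !gtn_eqF //; lia.
Qed.

Lemma completions_loop x c n : looping x c ->
  completions c n.+1 = completions c n + completions (step (~~ x) c) n.
Proof.
move=> lx; rewrite (completionsS _ x); congr (_ + _).
by apply: eq_cnt => w; rewrite looping_total.
Qed.

Definition dead (c : nat -> nat) : bool :=
  [exists m : 'I_l.+1,
    (k < c m) && [forall j : 'I_l.+1, (m < j) ==> (c j == 0)]].

Lemma deadP c : reflect
  (exists m, [/\ m <= l, k < c m & forall j, m < j <= l -> c j = 0]) (dead c).
Proof.
apply: (iffP existsP) => [[m /andP[km /forallP H]]|[m [ml km H]]].
  exists m; split=> //; first by rewrite -ltnS.
  move=> j /andP[mj jl]; have := H (Ordinal (jl : j < l.+1)).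
  by rewrite /= mj => /eqP.
exists (Ordinal (ml : m < l.+1)); rewrite km /=; apply/forallP => j.
by apply/implyP => mj; apply/eqP/H; rewrite mj -ltnS ltn_ord.
Qed.

(** If [w] contains the suffix of [p] from [m] on, the total exceeds [k]. Otherwise it contains no
    longer suffix either, and the total is 0, which is not [k]. *)
Lemma dead_completions c n : dead c -> completions c n = 0.
Proof.
move=> /deadP[m [ml km H]]; rewrite -(cnt_pred0 n); apply: eq_cnt => w /=.
have [|mw] := posnP (occ (drop m p) w); last first.
  by rewrite gtn_eqF // (leq_trans km) // leq_total.
move=> om; rewrite ltn_eqF // /total big1 // => -[j /= jl] _.
have [jm|mj] := leqP j m; last by rewrite H // mj.
apply/eqP; rewrite muln_eq0; apply/orP; right; rewrite -leqn0 leqNgt.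
by apply/negP => /(occ_drop_gt0 jm); rewrite om.
Qed.

(** * Invariants of reachable states and termination *)

Definition admissible (c : nat -> nat) : Prop :=
  c 0 = 1 /\ forall i j, i <= j -> 0 < c j -> 0 < c i.

Lemma admissible_init : admissible init_state.
Proof.
split=> // i j ij; rewrite /init_state !lt0b => /eqP j0.
by rewrite -leqn0 -j0.
Qed.

Lemma admissible_step x c : admissible c -> admissible (step x c).
Proof.
case=> c0 cD; split=> [|i j ij]; first by rewrite /step c0.
have [->//|ne] := eqVneq i j; have {ne}ij : i < j by rewrite ltn_neqAle ne.
rewrite /step addn_gt0 => H; rewrite addn_gt0; apply/orP; left.
case/orP: H; first by apply: cD; lia.
by case: j ij => // j ij; rewrite muln_gt0 => /andP[_]; apply: cD.
Qed.

Lemma leq_step x c j : c j <= step x c j. Proof. exact: leq_addr. Qed.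

(** The cap bounds the weight, so its strict growth on non-looping steps gives a termination
    measure. *)
Definition weight (c : nat -> nat) : nat := \sum_(j < l.+1) minn (c j) k.+1.

Lemma weight_le c : weight c <= l.+1 * k.+1.
Proof.
rewrite -[l.+1]card_ord -sum_nat_const; apply: leq_sum => j _.
exact: geq_minr.
Qed.

Lemma ltn_weight x c : ~~ looping x c -> weight c < weight (step x c).
Proof.
move=> /forallPn[j]; rewrite negb_imply negb_or -leqNgt => /and3P[/eqP Pj cj kc].
apply: (@ltn_sum_ord _ _ _ (lift ord0 j)) => [i|].
  by rewrite leq_min geq_min leq_step geq_minr.
by rewrite /step /= /bump /= add1n Pj eqxx mul1n add0n; lia.
Qed.

Lemma letter_cases (a x : bool) : a = x \/ a = ~~ x.
Proof. by case: a x => [] []; auto. Qed.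

Lemma eqb_negr_id (y : bool) : (y == ~~ y) = false.
Proof. by case: y. Qed.

(** Every letter of [p] loops, so saturation spreads from [c 0 = 1] up to [c l]. *)
Lemma looping_both c x : 0 < l -> admissible c ->
  looping x c -> looping (~~ x) c -> dead c.
Proof.
move=> l0 [c0 _] /loopingP l1 /loopingP l2; apply/deadP.
have sat j : j < l -> 0 < c j -> k < c j.+1.
  move=> jl; rewrite lt0n => /eqP cj.
  by have [Pj|Pj] := letter_cases (P j) x; [case: (l1 j jl Pj)|case: (l2 j jl Pj)].
exists l; split=> // [|j]; last by rewrite ltnNge andNb.
have: forall j, j < l -> k < c j.+1.
  elim=> [|j IH] jl; apply: sat => //; first by rewrite c0.
  by apply: leq_ltn_trans (IH _); [|apply: ltnW].
by case: l l0 => // l' _; apply.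
Qed.

(** * Upper bound on the degree *)

Section Potential.
Variable e : nat.
Hypotheses (e0 : 0 < e) (el : e < l) (Pe : P e.-1 != P e).

(* [j] is the gap between the [j]-th and the [j.+1]-st letter of [p], counted from
   1; it is a slot when it lies inside a run or at an end of [p]. *)
Definition slot j : bool := [|| j == 0, j == l | P j.-1 == P j].

(* Bounds the number of looping states still to be visited. Such a state loops
   on [x] only if no letter of [p] from the first unsaturated index (one past the
   last [j] with [k < c j]) to the first index [j] with [c j = 0] equals [x].
   So these indices lie in a single run, on one side of the fixed run boundary
   [e]: on the left leaving the state uses up a slot by increasing the longest
   matched prefix, on the right by saturating a further count. *)
Definition potential (c : nat -> nat) : nat :=
  \sum_(j < l.+1) (slot j && (if j < e then c j.+1 == 0 else c j <= k)).

Lemma potential_term_step x c j :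
  (slot j && (if j < e then step x c j.+1 == 0 else step x c j <= k)) <=
  (slot j && (if j < e then c j.+1 == 0 else c j <= k)).
Proof.
have leq_bool (a b : bool) : (a -> b) -> a <= b by case: a b => [] [] // ->.
apply: leq_bool => /andP[-> /=]; case: ifP => _.
  by rewrite -!leqn0; apply: leq_trans; apply: leq_step.
by apply: leq_trans; apply: leq_step.
Qed.

Lemma potential_step x c : potential (step x c) <= potential c.
Proof.
apply: leq_sum => j _; exact: potential_term_step.
Qed.

Lemma potential_loop x c : admissible c -> looping x c -> ~~ dead c ->
  potential (step (~~ x) c) < potential c.
Proof.
move=> [c0 cD] /loopingP lx /negP alive.
suff [j jl [js cj csj]] : exists2 j, j <= l & [/\ slot j,
    if j < e then c j.+1 == 0 else c j <= k &
    ~~ (if j < e then step (~~ x) c j.+1 == 0 else step (~~ x) c j <= k)].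
  apply: (@ltn_sum_ord _ _ _ (Ordinal (jl : j < l.+1))) => [i|].
    exact: potential_term_step.
  by rewrite /= js cj (negbTE csj).
have notx b : b <> x -> b = ~~ x by case: (letter_cases b x).
(* If [c e = 0], let [a.+1] be the first index of count zero. Looping forces [P a = ~~ x], so the
   step makes [c a.+1] positive. If [a] were not a slot, [P a.-1 = x] would saturate [c a] and the
   state would be dead. *)
have [ce|ce] := posnP (c e).
  have exz : exists m, c m == 0 by exists e; rewrite ce.
  case: (ex_minnP exz) => -[|a] /eqP ca amin; first by rewrite c0 in ca.
  have ae : a < e by apply: amin; rewrite ce.
  have al : a < l by apply: ltn_trans el.
  have c_a : 0 < c a.
    by rewrite lt0n; apply/negP => /amin; rewrite ltnn.
  have Pa : P a = ~~ x.
    by apply: notx => /(lx _ al); rewrite ca => -[c_a0|//]; rewrite c_a0 in c_a.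
  exists a; first exact: ltnW.
  rewrite ae ca; split=> //; last by rewrite /step ca Pa eqxx mul1n -lt0n.
  rewrite /slot; case: (posnP a) => [->//|a0]; rewrite /=.
  apply/orP; right; rewrite Pa; apply/eqP/notx => Pa1.
  have [] := lx a.-1 _ Pa1; first by lia.
    by move=> ca1; have := cD a.-1 a (leq_pred _) c_a; rewrite ca1.
  rewrite prednK // => kca; apply: alive; apply/deadP.
  exists a; split=> [||j /andP[aj _]] //; first exact: ltnW.
  apply/eqP; rewrite -leqn0 leqNgt; apply/negP => /(cD _ _ aj).
  by rewrite ca.
(* Now [c e > 0]. One of [P e.-1], [P e] is [x], so [e] or [e.+1] is saturated. With [m] the last
   saturated index, the step saturates [m.+1]; if [m.+1] were not a slot, [P m.+1 = x] would have
   saturated [m.+2]. *)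
have exs : exists m, [&& e <= m, m <= l & k < c m].
  have [Pe1|Pe1] := letter_cases (P e.-1) x.
    exists e; rewrite leqnn ltnW //=; have [] := lx e.-1 _ Pe1; first by lia.
      by move=> ce1; have := cD e.-1 e (leq_pred _) ce; rewrite ce1.
    by rewrite prednK.
  exists e.+1; rewrite leqnSn el /=; case: (lx e el) => [|ce0|//].
    by move: Pe; rewrite Pe1; case: (P e) (x) => [] [].
  by rewrite ce0 in ce.
have maxl m : [&& e <= m, m <= l & k < c m] -> m <= l by case/and3P.
case: (ex_maxnP exs maxl) => m /and3P[em ml km] mmax {exs maxl}.
have c_m : 0 < c m by apply: leq_ltn_trans km.
have ml' : m < l.
  rewrite ltn_neqAle ml andbT; apply/negP => /eqP mE.
  apply: alive; apply/deadP; exists m; split=> // j.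
  by rewrite mE ltnNge andNb.
have cm1 : c m.+1 <= k.
  by rewrite leqNgt; apply/negP => H; have := mmax m.+1; rewrite (leqW em) ml' H ltnn => /(_ isT).
have cm1_gt0 : 0 < c m.+1.
  rewrite lt0n; apply/negP => /eqP cm0; apply: alive; apply/deadP.
  exists m; split=> // j /andP[mj _].
  apply/eqP; rewrite -leqn0 leqNgt; apply/negP => /(cD _ _ mj).
  by rewrite cm0.
have Pm : P m = ~~ x.
  apply: notx => /(lx _ ml')[H|H]; first by rewrite H in c_m.
  by rewrite ltnNge cm1 in H.
exists m.+1 => //; rewrite ltnNge (leqW em) /= cm1; split=> //.
  rewrite /slot /= Pm; case: eqVneq => //= m1l.
  have m1l' : m.+1 < l by rewrite ltn_neqAle m1l.
  rewrite eq_sym; apply/eqP/notx => /(lx _ m1l')[H|H].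
    by rewrite H in cm1_gt0.
  by have := mmax m.+2; rewrite !leqW // m1l' H => /(_ isT); lia.
by rewrite /step Pm eqxx mul1n -ltnNge; lia.
Qed.

Lemma completions_poly c : admissible c -> exists2 q : {poly rat},
  eventually_poly (completions c) q & size q <= potential c.
Proof.
have [m] := ubnP (l.+1 * k.+1 - weight c).
elim: m c => // m IH c; rewrite ltnS => wc rc.
have [dc|alive] := boolP (dead c).
  exists 0%R; last by rewrite size_poly0.
  by exists 0 => n _; rewrite dead_completions // horner0.
have IHstep x : ~~ looping x c -> exists2 q : {poly rat},
    eventually_poly (completions (step x c)) q & size q <= potential (step x c).
  move=> /ltn_weight wx; apply: IH; last exact: admissible_step.
  by have := weight_le (step x c); lia.
(* The antidifference raises the size by one, which the strict drop of the potential pays for. *)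
have one x : looping x c -> exists2 q : {poly rat},
    eventually_poly (completions c) q & size q <= potential c.
  move=> lx; have [|q fq sq] := IHstep (~~ x).
    apply/negP => lx'; move/negP: alive; apply.
    by apply: (looping_both _ rc lx lx'); lia.
  have [Q fQ sQ] := eventually_poly_antidiff (fun n => completions_loop n lx) fq.
  exists Q => //; rewrite (leq_trans sQ) // (leq_ltn_trans sq) //.
  exact: potential_loop.
have [/one//|lt] := boolP (looping true c).
have [/one//|lf] := boolP (looping false c).
have [q fq sq] := IHstep _ lt; have [q' fq' sq'] := IHstep _ lf.
have [Q fQ sQ] := eventually_poly_shift (completionsS c true) fq fq'.
exists Q => //; rewrite (leq_trans sQ) // geq_max.
by rewrite (leq_trans sq) ?(leq_trans sq') ?potential_step.
Qed.

End Potential.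

(** * Lower bounds on the growth *)

(** Growth of order [n ^ d], in binomial form so that Pascal's rule lets each looping state raise
    [d] by one. *)
Definition grows (c : nat -> nat) (d : nat) : Prop :=
  exists N, forall n, 'C(n, d) <= completions c (N + n).

Lemma grows_step x c d : grows (step x c) d -> grows c d.
Proof.
case=> N H; exists N.+1 => n; rewrite addSn (completionsS _ x).
exact: leq_trans (leq_addr _ _).
Qed.

Lemma grows_iter m x c d : grows (iter m (step x) c) d -> grows c d.
Proof. by elim: m => //= m IH /grows_step. Qed.

Lemma grows_loop x c d :
  looping x c -> grows (step (~~ x) c) d -> grows c d.+1.
Proof.
move=> lx [N H]; exists N; elim=> [|n IH]; first by rewrite bin0n.
by rewrite binS addnS (completions_loop _ lx) leq_add.
Qed.

Lemma grows_end x c : looping x c -> c l = k -> grows c 0.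
Proof.
move=> lx cl; exists 0 => n; rewrite bin0 add0n.
elim: n => [|n IH]; first by rewrite /completions /= total_nil cl eqxx.
by rewrite (completions_loop _ lx) (leq_trans IH) ?leq_addr.
Qed.

(** Ensures that reading [x] turns no zero count positive. *)
Definition stable x (c : nat -> nat) : Prop :=
  forall j, j < l -> P j = x -> 0 < c j -> 0 < c j.+1.

(** Zero counts stay zero, and a count that [x] can raise gains at least one per letter, so it
    passes [k]. *)
Lemma looping_iter x c : stable x c -> looping x (iter k.+1 (step x) c).
Proof.
move=> st; set cm := fun m => iter m (step x) c.
have mono m j : c j <= cm m j.
  by elim: m => //= m IH; rewrite (leq_trans IH) // leq_step.
have zero m j : j <= l -> c j = 0 -> cm m j = 0.
  elim: m j => //= m IH j jl cj; rewrite /step (IH _ jl cj) add0n.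
  case: j jl cj => // j jl cj; case: eqP => // Pj; rewrite mul1n IH //.
    exact: ltnW.
  by apply/eqP; rewrite -leqn0 leqNgt; apply/negP => /(st _ jl Pj); rewrite cj.
have sat m j : j < l -> P j = x -> 0 < c j -> m <= cm m j.+1.
  move=> jl Pj cj; elim: m => //= m IH; rewrite /step Pj eqxx mul1n.
  by rewrite -addn1 leq_add // (leq_trans cj).
apply/loopingP => j jl Pj; have [cj|cj] := posnP (c j).
  by left; apply: (zero k.+1) => //; apply: ltnW.
by right; apply: (sat k.+1).
Qed.

Lemma iter_inv (Q : (nat -> nat) -> Prop) x m c :
  (forall c, Q c -> Q (step x c)) -> Q c -> Q (iter m (step x) c).
Proof. by move=> Qs Qc; elim: m => //= m; apply: Qs. Qed.

(* Reading [k.+1] copies of [x] first turns a stable state into a looping one. *)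
Lemma grows_slot (Q : (nat -> nat) -> Prop) x c d :
  stable x c -> (forall c, Q c -> Q (step x c)) -> Q c ->
  (forall c, Q c -> grows (step (~~ x) c) d) -> grows c d.+1.
Proof.
move=> st Qs Qc H; apply: (@grows_iter k.+1 x); apply: grows_loop.
  exact: looping_iter.
by apply: H; apply: iter_inv.
Qed.

Lemma grows_last_slot (Q : (nat -> nat) -> Prop) x c :
  stable x c -> (forall c, Q c -> Q (step x c)) -> Q c ->
  (forall c, Q c -> c l = k) -> grows c 0.
Proof.
move=> st Qs Qc H; apply: (@grows_iter k.+1 x); apply: grows_end.
  exact: looping_iter.
by apply: H; apply: iter_inv.
Qed.

(* The state after a prefix of [p] of length [j] has been embedded, in [v] ways,
   with no longer prefix occurring. *)
Definition matched j v (c : nat -> nat) : Prop :=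
  [/\ c j = v, forall i, j < i <= l -> c i = 0 & forall i, i <= j -> 0 < c i].

Lemma matched_step j v c : j < l ->
  matched j v c -> matched j.+1 v (step (P j) c).
Proof.
move=> jl [cj c0 cp]; split=> [|[//|i] /andP[ji il]|i].
- by rewrite /step c0 ?ltnSn // eqxx mul1n.
- by rewrite /step !c0 ?muln0 //; lia.
rewrite leq_eqVlt ltnS => /orP[/eqP ->|/cp ci].
  by rewrite /step /P eqxx mul1n addn_gt0 (cp j) ?orbT.
exact: leq_trans (leq_step _ _ _).
Qed.

Lemma matched_skip x j v c : (0 < j -> P j.-1 <> x) -> (j < l -> P j <> x) ->
  matched j v c -> matched j v (step x c).
Proof.
move=> Pj1 Pj [cj c0 cp]; split=> [|i /andP[ji il]|i /cp ci]; first 1 last.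
- case: i ji il => // i ji il; rewrite /step c0 ?ji //.
  have [ij|ij] := eqVneq i j; last by rewrite (c0 i) ?muln0 //; lia.
  by rewrite ij in il *; case: eqP => // /(Pj il).
- exact: leq_trans (leq_step _ _ _).
rewrite -cj /step; case: (j) Pj1 => [|i] /= Pi; first by rewrite addn0.
by case: (P i =P x) => [/(Pi isT)|_]; rewrite ?mul0n ?addn0.
Qed.

Lemma matched_stable x j v c : j <= l -> (j < l -> P j <> x) ->
  matched j v c -> stable x c.
Proof.
move=> jl Pj [_ c0 cp] i il Pi ci; have ij : i <= j.
  by rewrite leqNgt; apply/negP => ji; rewrite c0 // ji ltnW in ci.
have [E|ne] := eqVneq i j; last by apply: cp; rewrite ltn_neqAle ne.
by rewrite E in Pi il; case: (Pj il).
Qed.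

(** In a slot, [~~ P j] is neither the last embedded letter nor the next one, so any number of
    copies keeps the state matched. *)
Lemma grows_matched_step j v d : j < l ->
  (forall c, matched j v c -> grows (step (P j) c) d) ->
  forall c, matched j v c -> grows c (slot j + d).
Proof.
move=> jl H c mc; have [sj|_] := boolP (slot j); last exact/(grows_step (H _ mc)).
have nP : P j <> ~~ P j by case: (P j).
apply: (@grows_slot (matched j v) (~~ P j)) => //.
- by apply: matched_stable mc => //; apply: ltnW.
- move=> c'; apply: matched_skip => // j0.
  move: sj; rewrite /slot (gtn_eqF j0) (ltn_eqF jl) /= => /eqP ->.
  exact: nP.
by move=> c'; rewrite negbK; apply: H.
Qed.

Lemma grows_matched i j v d : i <= j <= l ->
  (forall c, matched j v c -> grows c d) ->
  forall c, matched i v c -> grows c (\sum_(i <= t < j) slot t + d).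
Proof.
move=> /andP[ij jl] H; rewrite -(subKn ij).
elim: (j - i) (leq_subr i j) => [|m IH] mj.
  by rewrite subn0 big_geq.
have lt : j - m.+1 < j by lia.
have E : (j - m.+1).+1 = j - m by lia.
rewrite big_ltn // -addnA E; apply: grows_matched_step => [|c mc].
  exact: leq_trans jl.
apply: IH; first exact: ltnW.
by rewrite -E; apply: matched_step => //; apply: leq_trans jl.
Qed.

Lemma grows_matched_end c : 0 < l -> matched l k c -> grows c 0.
Proof.
move=> l0 mc; have nP (b : bool) : b <> ~~ b by case: b.
apply: (@grows_last_slot (matched l k) (~~ P l.-1)) => // [|c'|c' []//].
  by apply: matched_stable mc; rewrite // ltnn.
by apply: matched_skip; rewrite ?ltnn.
Qed.

Lemma grows_matched_rest j c : 0 < l -> j <= l -> matched j k c ->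
  grows c (\sum_(j <= t < l) slot t).
Proof.
move=> l0 jl mc; rewrite -[X in grows _ X]addn0.
apply: grows_matched mc; first by rewrite jl leqnn.
by move=> c'; apply: grows_matched_end.
Qed.

(** * Reaching [k] occurrences through a single run *)

Lemma matched_init : matched 0 1 init_state.
Proof. by split=> // [[|i]|[|i]]. Qed.

(** Both neighbours differ from the letter at [t], so reading it [k] times keeps [c t = 1] and gives
    [c t.+1 = k]. *)
Lemma grows_single_letter t y : t < l -> P t = y ->
  (0 < t -> P t.-1 <> y) -> (t.+1 < l -> P t.+1 <> y) ->
  grows init_state (\sum_(0 <= j < l) slot j).
Proof.
move=> tl Pt Pt1 Pt2.
rewrite (big_cat_nat (n := t)) //=; last exact: ltnW.
apply: grows_matched matched_init; first exact: ltnW.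
rewrite big_ltn //; apply: grows_matched_step => // c mc.
apply: (@grows_iter k.-1 (P t)); rewrite -iterSr prednK //.
apply: grows_matched_rest => //; first exact: leq_ltn_trans tl.
have H m : [/\ iter m (step (P t)) c t = 1, iter m (step (P t)) c t.+1 = m,
    forall i, t.+1 < i <= l -> iter m (step (P t)) c i = 0 &
    forall i, i <= t -> 0 < iter m (step (P t)) c i].
  elim: m => [|m] /=.
    case: mc => ct c0 cp; split=> //; first by rewrite c0 ?ltnSn.
    by move=> i /andP[ti il]; rewrite c0 // il ltnW.
  set c' := iter m _ c => -[ct ct1 c0 cp]; split.
  - rewrite /step ct; case: (t) Pt Pt1 => // i Pi /(_ isT) /=.
    by rewrite -/P Pi; case: eqP.
  - by rewrite /step ct1 ct eqxx addn1.
  - case=> // i /andP[ti il]; rewrite /step c0 ?ti //.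
    have [E|ne] := eqVneq i t.+1; last by rewrite (c0 i) ?muln0 //; lia.
    by rewrite -/P E Pt; rewrite E in il; have := Pt2 il; case: eqP.
  by move=> i /cp ci; apply: leq_trans (leq_step _ _ _).
have [ct ct1 c0 cp] := H k; split=> // i.
by rewrite leq_eqVlt => /orP[/eqP ->|/cp//]; rewrite ct1.
Qed.

(** A block of [~~ y] precedes each of the first [b] copies of [y]; it cannot extend the run, as
    [c b] is still zero. The [s] extra copies follow. *)
Lemma grows_first_run b s y : 0 < b <= l -> (forall i, i < b -> P i = y) ->
  (b < l -> P b <> y) -> 'C(b + s, b) = k ->
  grows init_state (\sum_(0 <= j < l) slot j).
Proof.
move=> /andP[b0 bl] Py Pb kE.
(* The state after [m] copies of [y]: an occurrence of the prefix of length [i] chooses [i] of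
   them. *)
pose read m (c : nat -> nat) :=
  (forall i, i <= b -> c i = 'C(m, i)) /\ (forall i, b < i <= l -> c i = 0).
have read_y m c : read m c -> read m.+1 (step y c).
  case=> cb c0; split=> [[|i] ib|[//|i] /andP[bi il]].
  - by rewrite /step cb // !bin0.
  - by rewrite /step -/P Py // eqxx mul1n !cb ?binS // ltnW.
  rewrite /step c0 ?bi //; have [E|ne] := eqVneq i b; last by rewrite (c0 i) ?muln0 //; lia.
  by rewrite -/P E; rewrite E in il; have := Pb il; case: eqP.
have read_ny m c : m < b -> read m c -> read m (step (~~ y) c).
  move=> mb [cb c0]; split=> [[|i] ib|[//|i] /andP[bi il]].
  - by rewrite /step addn0 cb.
  - by rewrite /step -/P Py // eqb_negr_id mul0n addn0 cb.
  rewrite /step c0 ?bi //; have [E|ne] := eqVneq i b; last by rewrite (c0 i) ?muln0 //; lia.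
  by rewrite E cb // bin_small // muln0.
have -> : \sum_(0 <= j < l) slot j = b + \sum_(b <= j < l) slot j.
  rewrite (big_cat_nat (n := b)) //=; congr (_ + _).
  rewrite (eq_big_nat _ _ (F2 := fun=> 1)) ?sum_nat_const_nat ?subn0 ?muln1 //.
  move=> j /andP[_ jb]; rewrite /slot; case: j jb => [|j] jb //=.
  by rewrite -!/P !Py // 1?ltnW // eqxx orbT.
suff H m c : m <= b -> read (b - m) c -> grows c (m + \sum_(b <= j < l) slot j).
  apply: H => //; rewrite subnn; split=> [[|i]|[|i]] //=.
elim: m c => [|m IH] c mb.
  rewrite subn0 => rc; apply: (@grows_iter s y).
  apply: grows_matched_rest => //; first exact: leq_trans bl.
  have: read (b + s) (iter s (step y) c).
    by elim: (s) => [|s' IHs]; rewrite ?addn0 // addnS; apply: read_y.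
  case=> cb c0; split=> // [|i ib]; first by rewrite cb.
  by rewrite cb // bin_gt0; lia.
move=> rc; apply: (@grows_slot (read (b - m.+1)) (~~ y)) => [|c'|//|c' rc'].
- case: rc => cb c0 j jl Pj cj; have [jb|bj] := ltnP j b.
    by move: Pj; rewrite Py //; case: (y).
  move: cj; have [->|ne] := eqVneq j b; first by rewrite cb // bin_small //; lia.
  by rewrite c0 //; lia.
- by apply: read_ny; lia.
rewrite negbK; apply: IH; first exact: ltnW.
by have -> : b - m = (b - m.+1).+1 by [lia]; apply: read_y.
Qed.

Lemma grows_last_run t b s y : 0 < t -> 0 < b -> t + b = l ->
  (forall i, i < b -> P (t + i) = y) -> P t.-1 <> y -> 'C(b + s, b) = k ->
  grows init_state (\sum_(0 <= j < l) slot j).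
Proof.
move=> t0 b0 tb Py Pt kE.
have tl : t < l by lia.
(* Reading [~~ y] inflates [c t], and each later [y] passes the error on by one index. Hence only
   indices from [t + m] on are tracked; for [m = b] this leaves [c l]. *)
pose read m (c : nat -> nat) := (forall i, i <= t -> 0 < c i) /\
  (forall i, m <= i <= b -> c (t + i) = 'C(s + m, i)).
have pos x c : (forall i, i <= t -> 0 < c i) -> forall i, i <= t -> 0 < step x c i.
  by move=> cp i /cp ci; apply: leq_trans (leq_step _ _ _).
have read_y m c : read m c -> read m.+1 (step y c).
  case=> cp cb; split=> [|[//|i] /andP[mi ib]]; first exact: pos.
  rewrite addnS /step -/P Py // eqxx mul1n -addnS (cb i.+1); last by lia.
  by rewrite (cb i) ?addnS ?binS //; lia.
have read_ny m c : 0 < m -> read m c -> read m (step (~~ y) c).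
  move=> m0 [cp cb]; split=> [|[|i] /andP[mi ib]]; [exact: pos|lia|].
  by rewrite addnS /step -/P Py // eqb_negr_id mul0n addn0 -addnS cb ?mi.
have stable_ny c : (forall i, i <= t -> 0 < c i) -> stable (~~ y) c.
  move=> cp j jl Pj cj; apply: cp; rewrite ltnNge; apply/negP => tj.
  by move: Pj; rewrite -(subnKC tj) Py; [case: (y)|lia].
have -> : \sum_(0 <= j < l) slot j = \sum_(0 <= j < t) slot j + b.-1.
  rewrite (big_cat_nat (n := t)) //=; last exact: ltnW.
  congr (_ + _); rewrite big_ltn // /slot (gtn_eqF t0) (ltn_eqF tl) /= -!/P.
  have := Py 0 b0; rewrite addn0 => ->; case: eqP => //= _.
  rewrite add0n (eq_big_nat _ _ (F2 := fun=> 1)).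
    by rewrite sum_nat_const_nat muln1 -tb; lia.
  move=> j /andP[tj jl]; rewrite -!/P.
  rewrite -(subnKC (ltnW tj)) Py; last by lia.
  have -> : (t + (j - t)).-1 = t + (j - t.+1) by lia.
  by rewrite Py ?eqxx ?orbT //; lia.
apply: grows_matched matched_init; first exact: ltnW.
(* The [s] extra copies come with the first letter of the run, before any [~~ y] can disturb
   [c t = 1]. *)
move=> c [ct c0 cp]; apply: (@grows_iter s.+1 y).
have {ct c0 cp} : read 1 (iter s.+1 (step y) c).
  suff H m : [/\ iter m (step y) c t = 1,
      forall i, i <= t -> 0 < iter m (step y) c i &
      forall i, i <= b -> iter m (step y) c (t + i) = 'C(m, i)].
    have [_ cp' cb'] := H s.+1; split=> // i /andP[_ ib].
    by rewrite cb' // addn1.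
  elim: m => [|m] /=.
    split=> // -[|i] ib; first by rewrite addn0 ct.
    by rewrite c0 //; lia.
  set c' := iter m _ c => -[ct' cp' cb'].
  have E : step y c' t = 1.
    rewrite /step ct'; case: (t) Pt t0 => // i /= Pi _.
    by rewrite -/P; case: eqP.
  split=> //; first exact: pos.
  case=> [|i] ib; first by rewrite addn0 E.
  by rewrite addnS /step -/P Py // eqxx mul1n -addnS !cb' ?binS // ltnW.
suff H m c' : m < b -> read (b - m) c' -> grows c' m.
  by move=> rc; apply: H; [lia|have -> : b - b.-1 = 1 by lia].
elim: m c' => [|m IH] c' mb rc.
  apply: (@grows_last_slot (read b) (~~ y)) => [|c''||c'' [_ cb]].
  - by case: rc => cp _; apply: stable_ny.
  - exact: read_ny.
  - by rewrite subn0 in rc.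
  by rewrite -tb cb ?leqnn // addnC.
apply: (@grows_slot (read (b - m.+1)) (~~ y)) => [|c''|//|c'' rc''].
- by case: rc => cp _; apply: stable_ny.
- by apply: read_ny; lia.
rewrite negbK; apply: IH; first exact: ltnW.
by have -> : b - m = (b - m.+1).+1 by [lia]; apply: read_y.
Qed.


End States.

(** * Runs and slots *)

Lemma runs_cons a s : exists m rs, runs (a :: s) = (a, m) :: rs.
Proof.
rewrite /=; case: (runs s) => [|[c m] rs]; first by exists 1, [::].
by case: eqP => [->|_]; [exists m.+1, rs|exists 1, ((c, m) :: rs)].
Qed.

(** A letter prepended to a nonempty word creates either an inner slot or a new run. The slot at the
    right end is left out of the sum. *)
Lemma sum_slot s : 0 < size s ->
  \sum_(0 <= j < size s) slot s j + size (runs s) = (size s).+1.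
Proof.
elim: s => // a [|b s] IH _; first by rewrite big_nat1.
have := IH isT; rewrite [X in X + _ = _]big_ltn // => {}IH.
rewrite big_ltn // big_add1 big_ltn //=.
have -> : \sum_(1 <= j < (size s).+1) slot [:: a, b & s] j.+1 =
          \sum_(1 <= j < (size s).+1) slot (b :: s) j.
  by apply: eq_big_nat => -[|j].
have -> : slot [:: a, b & s] 1 = (a == b) :> nat by [].
have [m [rs E]] := runs_cons b s.
move: IH; rewrite -/(runs (b :: s)) E /=.
by case: (a == b) => /=; rewrite /slot /=; lia.
Qed.

(** Locates a run in the word: [t] is the total length of the runs before it. *)
Lemma run_positions s rs1 y b rs2 : runs s = rs1 ++ (y, b) :: rs2 ->
  exists t, [/\ 0 < b, t + b <= size s, forall i, i < b -> nth false s (t + i) = y,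
    0 < t -> nth false s t.-1 <> y & t + b < size s -> nth false s (t + b) <> y] /\
    ((t == 0) = nilp rs1) /\ ((t + b == size s) = nilp rs2).
Proof.
pose fl (rs : seq (bool * nat)) := flatten [seq nseq x.2 x.1 | x <- rs].
move=> E; have := runs_alt s; have := runs_pos s; have := flatten_runs s.
rewrite E map_cat flatten_cat /= all_cat -/(fl _) -/(fl _) => <-.
move=> /andP[pos1 /andP[/= b0 pos2]] alt.
have nilfl rs : all (fun x => 0 < x.2) rs -> (size (fl rs) == 0) = nilp rs.
  case: rs => // -[z m] rs /= /andP[m0 _].
  by rewrite /fl /= size_cat size_nseq addn_eq0 (gtn_eqF m0).
exists (size (fl rs1)); rewrite !size_cat size_nseq; split; last first.
  by rewrite nilfl // eqn_add2l -{1}[b]addn0 eqn_add2l eq_sym nilfl.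
split=> // [|i ib|t0|].
- by rewrite leq_add2l leq_addr.
- by rewrite nth_cat ltnNge leq_addr addKn nth_cat size_nseq ib nth_nseq ib.
- case/lastP: rs1 alt pos1 t0 {E} => [//|rs1 [z m]].
  rewrite cat_rcons !sorted_cat_cons all_rcons /=.
  move=> /andP[_ /andP[zy _]] /andP[m0 _] t0.
  rewrite nth_cat ltn_predL t0 nth_last /fl map_rcons flatten_rcons last_cat /=.
  have -> u : last u (nseq m z) = z by case: m m0 {t0} => // m _; elim: m u => /=.
  exact/eqP.
case: rs2 alt pos2 {E} => [|[z m] rs2]; first by rewrite /= !addn0 ltnn.
rewrite sorted_cat_cons /= => /andP[_ /andP[yz _]] /andP[m0 _] _.
rewrite nth_cat ltnNge leq_addr addKn nth_cat size_nseq ltnn subnn /fl /=.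
rewrite nth_cat size_nseq m0 nth_nseq m0.
by apply/eqP; rewrite eq_sym.
Qed.

(** * Degree bound and its attainment *)

Theorem theorem1p4 (k : nat) (hk : 0 < k)
    (l : nat) (p : l.-tuple bool)
    (r : nat) (hr : r = size (runs p)) (hr2 : 2 <= r) :
  exists q : {poly rat},
    [/\ eventually_poly (fun n => num_words p n k) q,
        size q <= (l - r + 1).+1 &
        (1 \in run_lengths p) \/
        (exists b s : nat,
           [/\ 2 <= b, boundary_run_length p b & 'C(b + s, b) = k]) ->
        size q = (l - r + 1).+1].
Proof.
have l0 : 0 < l.
  by rewrite -(size_tuple p); case: (tval p) hr => // hr; rewrite hr in hr2.
have nwE n : num_words p n k = completions k p init_state n.
  by rewrite num_wordsE; apply: eq_cnt => w; rewrite total_init.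
have slots : \sum_(0 <= j < l) slot p j = l - r + 1.
  have := @sum_slot p; rewrite size_tuple -hr => /(_ l0).
  by rewrite big_ltn // {1}/slot /=; lia.
(* The fixed boundary is the end of the first run, which is not all of [p] since [2 <= r]. *)
have [e [e0 el Pe]] : exists e,
    [/\ 0 < e, e < l & nth false p e.-1 != nth false p e].
  have [y [b [x [rs2 runsE]]]] : exists y b x rs2, runs p = [:: (y, b), x & rs2].
    by move: hr2; rewrite hr; case: (runs p) => [|[y b] [|x rs2]] // _;
       exists y, b, x, rs2.
  have [t [[b0 tb Py _ Pb] [/eqP t0 bl]]] := @run_positions p [::] y b _ runsE.
  rewrite t0 !add0n size_tuple in tb bl Pb.
  have lt_bl : b < l by rewrite ltn_neqAle tb andbT bl.
  exists b; split=> //; rewrite eq_sym; apply/eqP.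
  by have := Py b.-1; rewrite t0 add0n => ->; [apply: Pb|rewrite ltn_predL].
rewrite -(size_tuple p) in el.
have [q fq sq] := completions_poly hk e0 el Pe admissible_init.
have sq' : size q <= (l - r + 1).+1.
  (* The slot at the right end of [p] accounts for the last unit. *)
  apply: leq_trans sq _; rewrite /potential size_tuple big_ord_recr /= -slots -[X in _ <= X]addn1.
  rewrite leq_add ?leq_b1 // big_mkord; apply: leq_sum => j _.
  by case: (slot p j) => //=; apply: leq_b1.
exists q; split=> //.
  by case: fq => N H; exists N => n Nn; rewrite nwE H.
move=> cond; apply/eqP; rewrite eqn_leq sq' /=.
suff [N H] : grows k p init_state (l - r + 1).
  exact: eventually_poly_growth fq H.
have lastE (rs : seq (bool * nat)) x0 b : rs != [::] -> last x0 [seq x.2 | x <- rs] = b ->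
    exists rs1 y, rs = rs1 ++ [:: (y, b)].
  case/lastP: rs => // rs [y b'] _; rewrite map_rcons last_rcons => <-.
  by exists rs, y; rewrite cats1.
have -> : l - r + 1 = \sum_(0 <= j < size p) slot p j by rewrite size_tuple slots.
case: cond => [/mapP[[y b] p_yb b1]|[b [s [b2 bnd kE]]]].
  case/splitPr runsE : (runs p) / p_yb => [rs1 rs2] /= in b1 *.
  have [t [[_ tb Py Pt Pb] _]] := run_positions runsE.
  rewrite -{}b1 addn1 in tb Py Pb.
  apply: (@grows_single_letter _ _ hk t y) => //.
  by have := Py 0 isT; rewrite addn0.
case: bnd => [bE|bE].
  case runsE : (runs p) hr hr2 => [|[y b'] rs2]; first by move=> ->.
  have /= {}bE : b = b' by rewrite bE /run_lengths runsE.
  move=> _ _; have [t [[b0 tb Py _ Pb] [/eqP t0 _]]] := @run_positions p [::] y b' _ runsE.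
  rewrite -{}bE {}t0 !add0n in b0 tb Py Pb *.
  by apply: (@grows_first_run _ _ hk b s y) => //; rewrite b0.
have ne : runs p != [::] by rewrite -size_eq0 -hr; lia.
have [rs1 [y runsE]] := lastE _ _ _ ne (esym bE).
have [t [[b0 tb Py Pt _] [t0 /eqP tl]]] := run_positions runsE.
have tpos : 0 < t.
  by rewrite lt0n t0; case: (rs1) runsE => // E; rewrite hr E in hr2.
exact: (@grows_last_run _ _ hk t b s y tpos b0 tl Py (Pt tpos) kE).
Qed.
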